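(* Let $p=2$ with normalized data, let $\hat\beta=(\hat\beta_1,\hat\beta_2)$ be the common center of the equimomental ellipses, and let $t>0$. The solutions $\beta_1,\beta_2$ of the lasso with $|\beta_1|+|\beta_2|\le t$ are: (1) For $t\le\min\{|\hat\beta_1+\hat\beta_2|,|\hat\beta_1-\hat\beta_2|\}$, one of the $\beta_i$ vanishes, while the other one is equal to $t$ or $-t$: (a) if $\hat\beta_1+\hat\beta_2>t$ and $\hat\beta_2-\hat\beta_1>t$, then $(\beta_1,\beta_2)=(0,t)$; (b) if $-\hat\beta_1-\hat\beta_2>t$ and $\hat\beta_2-\hat\beta_1>t$, then $(\beta_1,\beta_2)=(-t,0)$; (c) if $\hat\beta_1-\hat\beta_2>t$ and $-\hat\beta_1-\hat\beta_2>t$, then $(\beta_1,\beta_2)=(0,-t)$; (d) if $\hat\beta_1+\hat\beta_2>t$ and $\hat\beta_1-\hat\beta_2>t$, then $(\beta_1,\beta_2)=(t,0)$. (2) For $|\hat\beta_1-\hat\beta_2|<t<|\hat\beta_1+\hat\beta_2|$: (a) if $\hat\beta_1+\hat\beta_2>t$, then $\beta_1=(t+\hat\beta_1-\hat\beta_2)/2$, $\beta_2=(t-\hat\beta_1+\hat\beta_2)/2$; (b) if $-\hat\beta_1-\hat\beta_2>t$, then $\beta_1=(-t+\hat\beta_1-\hat\beta_2)/2$, $\beta_2=(-t-\hat\beta_1+\hat\beta_2)/2$. (3) For $|\hat\beta_1+\hat\beta_2|<t<|\hat\beta_1-\hat\beta_2|$: (a) if $\hat\beta_2-\hat\beta_1>t$,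 then $\beta_1=(-t+\hat\beta_1+\hat\beta_2)/2$, $\beta_2=(t+\hat\beta_1+\hat\beta_2)/2$; (b) if $\hat\beta_1-\hat\beta_2>t$, then $\beta_1=(t+\hat\beta_1+\hat\beta_2)/2$, $\beta_2=(-t+\hat\beta_1+\hat\beta_2)/2$. (4) For $t>\max\{|\hat\beta_1+\hat\beta_2|,|\hat\beta_1-\hat\beta_2|\}$, $\beta_1=\hat\beta_1$, $\beta_2=\hat\beta_2$.
   Context: The covariance matrix of the two (centered) predictors is $K=\begin{pmatrix} 1 & J_{12} \\ J_{12} & 1 \end{pmatrix}$ with $|J_{12}|<1$ (normalized data, full rank). The lasso solution for the bound $t$ is the minimizer over $\{(\beta_1,\beta_2):|\beta_1|+|\beta_2|\le t\}$ of the least square objective function, which up to an additive constant and a positive factor equals $\langle K(\beta-\hat\beta),\beta-\hat\beta\rangle$. Its level sets are the equimomental ellipses, with common center $\hat\beta=K^{-1}b\in\mathbb R^2$ (the unconstrained least square minimizer), where $b$ is the vector of covariances of the response with the two predictors. *)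

(* Defs.v *)
From mathcomp Require Import all_boot all_order all_algebra.

Set Implicit Arguments.
Unset Strict Implicit.
Unset Printing Implicit Defensive.

Import Order.TTheory GRing.Theory Num.Theory.
Local Open Scope ring_scope.

Definition mean (R : realFieldType) (n : nat) (u : 'cV[R]_n) : R :=
  n%:R^-1 * \sum_(i < n) u i 0.

Definition cov (R : realFieldType) (n : nat) (u v : 'cV[R]_n) : R :=
  n%:R^-1 * \sum_(i < n) (u i 0 - mean u) * (v i 0 - mean v).

(* A data set has n observations and p predictors: column j of X holds the
   observed values of the j-th predictor, y those of the response. *)
Definition covmx (R : realFieldType) (n p : nat) (X : 'M[R]_(n, p)) : 'M[R]_p :=
  \matrix_(j < p, k < p) cov (col j X) (col k X).

Definition covvec (R : realFieldType) (n p : nat)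
    (X : 'M[R]_(n, p)) (y : 'cV[R]_n) : 'cV[R]_p :=
  \col_(j < p) cov (col j X) y.

(* For n = 0 the variance is 0, so a normalized data set with p > 0 is
   nonempty. *)
Definition normalized (R : realFieldType) (n p : nat) (X : 'M[R]_(n, p)) : Prop :=
  forall j : 'I_p, mean (col j X) = 0 /\ cov (col j X) (col j X) = 1.

(* There is no intercept term: when the predictors are centered, fitting an
   intercept (or centering y) changes this function only by a constant. *)
Definition least_squares (R : realFieldType) (n p : nat)
    (X : 'M[R]_(n, p)) (y : 'cV[R]_n) (beta : 'cV[R]_p) : R :=
  \sum_(i < n) (y i 0 - (X *m beta) i 0) ^+ 2.

(* Common center of the level sets of least_squares X y; meaningful only when
   the covariance matrix is invertible. *)
Definition ls_center (R : realFieldType) (n p : nat)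
    (X : 'M[R]_(n, p)) (y : 'cV[R]_n) : 'cV[R]_p :=
  invmx (covmx X) *m covvec X y.

Definition l1norm (R : realFieldType) (p : nat) (beta : 'cV[R]_p) : R :=
  \sum_(j < p) `|beta j 0|.

Definition lasso_solution (R : realFieldType) (n p : nat)
    (X : 'M[R]_(n, p)) (y : 'cV[R]_n) (t : R) (beta : 'cV[R]_p) : Prop :=
  l1norm beta <= t /\
  forall gamma : 'cV[R]_p,
    l1norm gamma <= t -> least_squares X y beta <= least_squares X y gamma.

(* Main.v *)
Require Import Defs.
From mathcomp Require Import all_boot all_order all_algebra.
From mathcomp Require Import ring lra.

(* Up to an additive constant and the positive factor n, the objective is the
   quadratic form of K at beta - bh.  For p = 2 the coordinates s = beta_1 + beta_2 and
   d = beta_1 - beta_2 diagonalize K, with positive eigenvalues 1 + J and 1 - J,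
   and turn the l1 ball into the square max(|s|, |d|) <= t.  The minimization
   thus splits into two independent ones over [-t, t], each solved by truncating
   the corresponding coordinate of bh; in particular J plays no role. *)

Set Implicit Arguments.
Unset Strict Implicit.
Unset Printing Implicit Defensive.

Import Order.TTheory GRing.Theory Num.Theory.
Local Open Scope ring_scope.

(** * Sums and determinants of size two *)

Lemma sum_ord2 (V : nmodType) (F : 'I_2 -> V) : \sum_(i < 2) F i = F 0 + F 1.
Proof.
rewrite big_ord_recl big_ord1; congr (F _ + F _); exact/val_inj.
Qed.

Lemma det_mx22 (R : comPzRingType) (A : 'M[R]_2) :
  \det A = A 0 0 * A 1 1 - A 0 1 * A 1 0.
Proof.
rewrite (expand_det_row _ 0) sum_ord2 /cofactor !det_mx11 !mxE /=.
rewrite expr0 expr1 mul1r mulN1r mulrN.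
by congr (_ * A _ _ - _ * A _ _); apply/val_inj.
Qed.

(** * Covariances and the least squares objective *)

Lemma cov_centered (R : realFieldType) (n : nat) (u v : 'cV[R]_n) :
  mean u = 0 -> cov u v = n%:R^-1 * (u^T *m v) 0 0.
Proof.
move=> mu0; rewrite /cov mu0 mxE.
under eq_bigr do rewrite subr0 mulrBr.
(* The constant [mean v] factors out and is multiplied by [mean u], which vanishes. Thus [v] may be
   an uncentered response. *)
rewrite big_split /= sumrN -mulr_suml mulrBr (mulrA _ _ (mean v)).
rewrite -/(mean u) mu0 mul0r subr0.
by congr (_ * _); apply: eq_bigr => i _; rewrite mxE.
Qed.

Lemma normalized_gt0 (R : realFieldType) (n p : nat) (X : 'M[R]_(n, p.+1)) :
  normalized X -> (0 < n)%N.
Proof.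
case: n X => // X /(_ 0) [_].
by rewrite /cov big_ord0 mulr0 => /esym/eqP; rewrite oner_eq0.
Qed.

Lemma covmx_normalized (R : realFieldType) (n p : nat) (X : 'M[R]_(n, p)) :
  normalized X -> covmx X = n%:R^-1 *: (X^T *m X).
Proof.
move=> hX; apply/matrixP => j k; rewrite !mxE cov_centered ?(hX j).1 // mxE.
by congr (_ * _); apply: eq_bigr => i _; rewrite !mxE.
Qed.

Lemma covvec_normalized (R : realFieldType) (n p : nat) (X : 'M[R]_(n, p))
    (y : 'cV[R]_n) :
  normalized X -> covvec X y = n%:R^-1 *: (X^T *m y).
Proof.
move=> hX; apply/matrixP => j k; rewrite !mxE cov_centered ?(hX j).1 // mxE.
by congr (_ * _); apply: eq_bigr => i _; rewrite !mxE ?ord1.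
Qed.

Lemma least_squaresE (R : realFieldType) (n p : nat) (X : 'M[R]_(n, p))
    (y : 'cV[R]_n) (beta : 'cV[R]_p) :
  least_squares X y beta = ((y - X *m beta)^T *m (y - X *m beta)) 0 0.
Proof. by rewrite mxE; apply: eq_bigr => i _; rewrite !mxE expr2. Qed.

(** The center solves K c = b; multiplying by n turns K and b into X^T X and X^T y. *)
Lemma normal_equations (R : realFieldType) (n p : nat) (X : 'M[R]_(n, p))
    (y : 'cV[R]_n) :
  (0 < n)%N -> normalized X -> covmx X \in unitmx ->
  X^T *m (y - X *m ls_center X y) = 0.
Proof.
move=> n_gt0 hX Ku.
have n0 : n%:R != 0 :> R by rewrite pnatr_eq0 -lt0n.
have XX : X^T *m X = n%:R *: covmx X.
  by rewrite covmx_normalized // scalerA mulfV // scale1r.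
have Xy : X^T *m y = n%:R *: covvec X y.
  by rewrite covvec_normalized // scalerA mulfV // scale1r.
by rewrite mulmxBr mulmxA XX Xy -scalemxAl mulKVmx // subrr.
Qed.

(** Pythagoras: the residual at [beta] is r - X h, where the residual r at the center is orthogonal
    to the columns of X, so the cross terms vanish. *)
Lemma least_squares_center (R : realFieldType) (n p : nat) (X : 'M[R]_(n, p))
    (y : 'cV[R]_n) (beta : 'cV[R]_p) (h := beta - ls_center X y) :
  (0 < n)%N -> normalized X -> covmx X \in unitmx ->
  least_squares X y beta =
    least_squares X y (ls_center X y) + n%:R * (h^T *m covmx X *m h) 0 0.
Proof.
move=> n_gt0 hX Ku; have n0 : n%:R != 0 :> R by rewrite pnatr_eq0 -lt0n.
set r := y - X *m ls_center X y.
have Xr : X^T *m r = 0 by exact: normal_equations.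
have rX : r^T *m X = 0 by rewrite -[LHS]trmxK trmx_mul trmxK Xr trmx0.
have -> : least_squares X y beta = ((r - X *m h)^T *m (r - X *m h)) 0 0.
  have -> : r - X *m h = y - X *m beta.
    by rewrite /r /h mulmxBr opprB addrA subrK.
  exact: least_squaresE.
rewrite least_squaresE -/r covmx_normalized // -scalemxAr -scalemxAl.
clearbody r h.
have -> : (r - X *m h)^T = r^T - h^T *m X^T by rewrite linearB /= trmx_mul.
rewrite mulmxBl !mulmxBr !mulmxA rX -(mulmxA _ X^T r) Xr.
rewrite mul0mx mulmx0 subr0 sub0r opprK !mxE mulrA mulfV // mul1r.
by congr (_ + _); rewrite mxE.
Qed.

Lemma quadratic_form2 (R : comPzRingType) (K : 'M[R]_2) (h : 'cV[R]_2) :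
  (h^T *m K *m h) 0 0 =
    K 0 0 * h 0 0 ^+ 2 + (K 0 1 + K 1 0) * h 0 0 * h 1 0 + K 1 1 * h 1 0 ^+ 2.
Proof. by rewrite mxE sum_ord2 !mxE !sum_ord2 !mxE; ring. Qed.

(** * Diagonalization for two predictors *)

Section TwoPredictors.

Variables (R : realFieldType) (n : nat) (X : 'M[R]_(n, 2)) (y : 'cV[R]_n).
Hypotheses (hX : normalized X) (hJ : `|covmx X 0 1| < 1).

Let J := covmx X 0 1.
Let bh := ls_center X y.

Lemma covmx2_entries :
  [/\ covmx X 0 0 = 1, covmx X 1 1 = 1 & covmx X 1 0 = J].
Proof.
split; rewrite /J !mxE ?(hX _).2 //.
by congr (_ * _); apply: eq_bigr => i _; rewrite mulrC.
Qed.

(** The determinant is 1 - J^2, which is positive. *)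
Lemma covmx2_unit : covmx X \in unitmx.
Proof.
have [K00 K11 K10] := covmx2_entries; rewrite unitmxE det_mx22 unitfE.
rewrite K00 K11 K10 -/J lt0r_neq0 //.
by move: hJ; rewrite -/J ltr_norml => /andP[? ?]; nra.
Qed.

(** Since K has unit diagonal, its form is x^2 + 2 J x y + y^2, which is half of (1 + J) (x + y)^2 +
    (1 - J) (x - y)^2. *)
Lemma least_squares2 (beta : 'cV[R]_2) :
  least_squares X y beta = least_squares X y bh + n%:R / 2 *
    ((1 + J) * ((beta 0 0 + beta 1 0) - (bh 0 0 + bh 1 0)) ^+ 2 +
     (1 - J) * ((beta 0 0 - beta 1 0) - (bh 0 0 - bh 1 0)) ^+ 2).
Proof.
have [K00 K11 K10] := covmx2_entries.
rewrite least_squares_center ?(normalized_gt0 hX) ?covmx2_unit // -/bh.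
have hE i : (beta - bh) i 0 = beta i 0 - bh i 0.
  by rewrite mxE [X in _ + X]mxE.
rewrite quadratic_form2 K00 K11 K10 -/J !hE.
by field.
Qed.

End TwoPredictors.

(** * Projection onto the interval [-t, t] *)

Definition truncate (R : realFieldType) (t s : R) : R :=
  Num.max (- t) (Num.min s t).

Lemma truncate_norm (R : realFieldType) (t s : R) :
  0 <= t -> `|truncate t s| <= t.
Proof.
move=> t0; rewrite ler_norml /truncate.
by rewrite le_max lexx /= ge_max ge_min lexx orbT andbT; lra.
Qed.

Lemma truncate_low (R : realFieldType) (t s : R) :
  0 <= t -> s <= - t -> truncate t s = - t.
Proof. by move=> t0 st; rewrite /truncate min_l ?max_l //; lra. Qed.

Lemma truncate_high (R : realFieldType) (t s : R) :
  0 <= t -> t <= s -> truncate t s = t.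
Proof. by move=> t0 st; rewrite /truncate min_r ?max_r //; lra. Qed.

Lemma truncate_id (R : realFieldType) (t s : R) :
  `|s| <= t -> truncate t s = s.
Proof.
by rewrite ler_norml => /andP[? ?]; rewrite /truncate min_l ?max_r.
Qed.

Lemma truncate_norm_ge (R : realFieldType) (t s : R) :
  0 <= t -> t <= `|s| -> truncate t s = t \/ truncate t s = - t.
Proof.
move=> t0; rewrite ler_normr => /orP[ts|ts]; [left|right].
  exact: truncate_high.
by apply: truncate_low => //; lra.
Qed.

(* The obtuse-angle inequality for the projection of s onto [-t, t]. *)
Lemma truncate_projection (R : realFieldType) (t s u : R) : `|u| <= t ->
  (truncate t s - s) ^+ 2 + (u - truncate t s) ^+ 2 <= (u - s) ^+ 2.
Proof.
move=> ut; have t0 : 0 <= t by exact: le_trans ut.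
move: ut; rewrite ler_norml => /andP[ut1 ut2].
case: (leP t `|s|) => [|/ltW st].
  rewrite ler_normr => /orP[ts|ts].
    by rewrite truncate_high //; nra.
  by rewrite truncate_low //; [nra|lra].
by rewrite truncate_id // subrr expr0n /= add0r.
Qed.

(** * The lasso in the coordinates s and d *)

Lemma l1norm2_le (R : realFieldType) (t : R) (b : 'cV[R]_2) :
  (l1norm b <= t) = (`|b 0 0 + b 1 0| <= t) && (`|b 0 0 - b 1 0| <= t).
Proof.
have -> : l1norm b = `|b 0 0| + `|b 1 0|.
  exact: sum_ord2.
rewrite !ler_norml; apply/idP/idP.
  by case: (ger0P (b 0 0)); case: (ger0P (b 1 0)) => ? ? ?;
    apply/andP; split; apply/andP; split; lra.
by move=> /andP[/andP[? ?] /andP[? ?]];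
  case: (ger0P (b 0 0)); case: (ger0P (b 1 0)) => ? ?; lra.
Qed.

(** Sum and difference determine [beta], so this equivalence yields existence, uniqueness and the
    explicit formulas at once. *)
Lemma lasso_solution2P (R : realFieldType) (n : nat) (X : 'M[R]_(n, 2))
    (y : 'cV[R]_n) (t : R) (bh := ls_center X y) (beta : 'cV[R]_2) :
  normalized X -> `|covmx X 0 1| < 1 -> 0 <= t ->
  lasso_solution X y t beta <->
    beta 0 0 + beta 1 0 = truncate t (bh 0 0 + bh 1 0) /\
    beta 0 0 - beta 1 0 = truncate t (bh 0 0 - bh 1 0).
Proof.
move=> hX hJ t0.
have n2 : 0 < n%:R / 2 :> R.
  by rewrite divr_gt0 ?ltr0n ?(normalized_gt0 hX).
have /andP[J1 J2] : -1 < covmx X 0 1 < 1 by rewrite -ltr_norml.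
rewrite /lasso_solution l1norm2_le -/bh.
set s := bh 0 0 + bh 1 0; set d := bh 0 0 - bh 1 0.
split=> [[/andP[sb db] min_b]|[sb db]].
  (* The competitor [g] is the point of the ball whose sum and difference are the truncated ones. *)
  pose g : 'cV[R]_2 := \col_i (if i == 0
    then (truncate t s + truncate t d) / 2
    else (truncate t s - truncate t d) / 2).
  have gs : g 0 0 + g 1 0 = truncate t s by rewrite !mxE /=; field.
  have gd : g 0 0 - g 1 0 = truncate t d by rewrite !mxE /=; field.
  have := min_b g; rewrite l1norm2_le gs gd !truncate_norm // => /(_ isT).
  rewrite (least_squares2 y hX hJ beta) (least_squares2 y hX hJ g).
  rewrite lerD2l ler_pM2l // -/bh -/s -/d gs gd.
  (* Weighting the two projection inequalities by 1 + J and 1 - J and adding the minimality of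
     [beta] against [g] bounds a positive combination of the squared distances to the truncations by
     0; hence both vanish. *)
  have := truncate_projection s sb; have := truncate_projection d db.
  set u := _ + beta 1 0; set v := _ - beta 1 0 => pd ps le_bg.
  have u0 : 0 <= (u - truncate t s) ^+ 2 by exact: sqr_ge0.
  have v0 : 0 <= (v - truncate t d) ^+ 2 by exact: sqr_ge0.
  by split; apply/eqP; rewrite -subr_eq0 -sqrf_eq0 eq_le ?u0 ?v0 andbT; nra.
rewrite sb db !truncate_norm //; split=> // g.
rewrite l1norm2_le => /andP[sg dg].
rewrite (least_squares2 y hX hJ beta) (least_squares2 y hX hJ g).
rewrite lerD2l ler_pM2l // -/bh -/s -/d sb db.
(* The two coordinates are compared separately; in each, the projection inequality is used with its
   second square dropped. *)
apply: lerD; rewrite ler_pM2l; try lra.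
  by apply: le_trans (truncate_projection s sg); rewrite lerDl sqr_ge0.
by apply: le_trans (truncate_projection d dg); rewrite lerDl sqr_ge0.
Qed.

Theorem theorem4p1 (R : realFieldType) (n : nat)
    (X : 'M[R]_(n, 2)) (y : 'cV[R]_n) (t : R)
    (hX : normalized X) (hJ : `|covmx X 0 1| < 1) (ht : 0 < t) :
  let bh1 := ls_center X y 0 0 in
  let bh2 := ls_center X y 1 0 in
  (exists! beta : 'cV[R]_2, lasso_solution X y t beta) /\
  (forall beta : 'cV[R]_2, lasso_solution X y t beta ->
    let b1 := beta 0 0 in
    let b2 := beta 1 0 in
    [/\ t <= Num.min `|bh1 + bh2| `|bh1 - bh2| ->
          ((b1 = 0 /\ (b2 = t \/ b2 = - t)) \/
           (b2 = 0 /\ (b1 = t \/ b1 = - t))) /\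
          [/\ t < bh1 + bh2 -> t < bh2 - bh1 -> b1 = 0 /\ b2 = t,
              t < - bh1 - bh2 -> t < bh2 - bh1 -> b1 = - t /\ b2 = 0,
              t < bh1 - bh2 -> t < - bh1 - bh2 -> b1 = 0 /\ b2 = - t
            & t < bh1 + bh2 -> t < bh1 - bh2 -> b1 = t /\ b2 = 0],
        `|bh1 - bh2| < t < `|bh1 + bh2| ->
          (t < bh1 + bh2 ->
             b1 = (t + bh1 - bh2) / 2 /\ b2 = (t - bh1 + bh2) / 2) /\
          (t < - bh1 - bh2 ->
             b1 = (- t + bh1 - bh2) / 2 /\ b2 = (- t - bh1 + bh2) / 2),
        `|bh1 + bh2| < t < `|bh1 - bh2| ->
          (t < bh2 - bh1 ->
             b1 = (- t + bh1 + bh2) / 2 /\ b2 = (t + bh1 + bh2) / 2) /\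
          (t < bh1 - bh2 ->
             b1 = (t + bh1 + bh2) / 2 /\ b2 = (- t + bh1 + bh2) / 2)
      & Num.max `|bh1 + bh2| `|bh1 - bh2| < t ->
          b1 = bh1 /\ b2 = bh2]).
Proof.
move=> bh1 bh2; have t0 := ltW ht; split.
  pose s := truncate t (bh1 + bh2); pose d := truncate t (bh1 - bh2).
  exists (\col_i (if i == 0 then (s + d) / 2 else (s - d) / 2)); split.
    apply/lasso_solution2P => //; rewrite -/bh1 -/bh2 -/s -/d !mxE /=.
    by split; field.
  move=> b /lasso_solution2P-/(_ hX hJ t0)[]; rewrite -/bh1 -/bh2 -/s -/d.
  move=> sb db; apply/colP => i; rewrite !mxE.
  have [->|i1] := eqVneq i 0; first lra.
  have -> : i = 1 by apply/val_inj; case: i i1 => [[|[]]].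
  lra.
move=> b /lasso_solution2P-/(_ hX hJ t0)[]; rewrite -/bh1 -/bh2.
move=> + + b1 b2; rewrite -/b1 -/b2 => sb db; split.
- rewrite le_min => /andP[ts td]; split.
    (* Both coordinates saturate at t or -t; the four sign choices are the four vertices of the l1
       ball. *)
    have := truncate_norm_ge t0 ts; have := truncate_norm_ge t0 td.
    rewrite -sb -db => -[?|?] [?|?].
    + by right; split; [|left]; lra.
    + by left; split; [|right]; lra.
    + by left; split; [|left]; lra.
    + by right; split; [|right]; lra.
  split=> hs hd; move: sb db.
  + by rewrite truncate_high ?truncate_low //; try lra; split; lra.
  + by rewrite !truncate_low //; try lra; split; lra.
  + by rewrite truncate_low ?truncate_high //; try lra; split; lra.
  + by rewrite !truncate_high //; try lra; split; lra.
(* The difference keeps its value at the center while the sum saturates, which gives a point on an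
   edge; the next case exchanges the two roles. *)
- move=> /andP[/ltW dt _]; rewrite (truncate_id dt) in db.
  split=> hs; move: sb.
    by rewrite truncate_high //; try lra; split; lra.
  by rewrite truncate_low //; try lra; split; lra.
- move=> /andP[/ltW st _]; rewrite (truncate_id st) in sb.
  split=> hd; move: db.
    by rewrite truncate_low //; try lra; split; lra.
  by rewrite truncate_high //; try lra; split; lra.
(* The center lies in the ball, so neither coordinate is changed. *)
rewrite gt_max => /andP[/ltW st /ltW dt].
by move: sb db; rewrite !truncate_id // => sb db; split; lra.
Qed.
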